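(* Let $X$ be a topological graph. The following statements are equivalent: (1) $X$ is homeomorphic to the unit circle $\mathbb{S}^1$; (2) $P_h(X)=\{0,1,2,\ldots\}\cup\{+\infty\}$; (3) $0\in P_h(X)$; (4) all vertices of $X$ have degree $2$.
   Context: A topological graph is a compact connected metric space $X$ which is a finite union of arcs (spaces homeomorphic to $[0,1]$; the points corresponding to $0,1$ are the end points) such that any two of these arcs intersect in at most their end points; the vertices of $X$ are the end points of these arcs (edges), and the degree of a vertex is the number of edges having it as an end point. $\mathbb{S}^1=\{e^{2\pi i\theta}:\theta\in[0,1]\}$. For a topological space $A$, $Homeo(A)$ denotes the group of all homeomorphisms $A\to A$ under composition. For a subgroup $G$ of $Homeo(A)$ (acting by $gx=g(x)$), a nonempty subset $Y\subseteq A$ is invariant if $g(y)\in Y$ for all $g\in G$, $y\in Y$. The height of $(G,A)$ is $h(G,A)=\sup\{n\geq 0:$ there exist distinct closed invariant subsets $Y_0\subset Y_1\subset\cdots\subset Y_n=A\}$ (possibly $+\infty$). Finally $P_h(A)=\{h(G,A): G \text{ is a subgroup of } Homeo(A)\}$. *)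

(* Defs.v *)
From HB Require Import structures.
From mathcomp Require Import all_boot all_order all_algebra.
From mathcomp Require Import all_classical all_reals all_analysis.
Set Implicit Arguments. Unset Strict Implicit. Unset Printing Implicit Defensive.
Import Order.TTheory GRing.Theory Num.Theory.
Import numFieldNormedType.Exports.
Local Open Scope classical_set_scope.
Local Open Scope ring_scope.

Section Defs.
Variable R : realType.

Definition unit_interval : set R := `[0, 1]%classic.

Definition arc_of (X : topologicalType) (f : R -> X) : set X :=
  f @` unit_interval.

Definition arc_param (X : topologicalType) (f : R -> X) : Prop :=
  exists g : X -> R,
    {within unit_interval, continuous f} /\
    {within arc_of f, continuous g} /\
    (forall t, unit_interval t -> g (f t) = t).

Definition endpoints (X : topologicalType) (f : R -> X) : set X :=
  [set f 0; f 1].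

Definition graph_edges (X : topologicalType) (n : nat) (e : 'I_n -> R -> X)
  : Prop :=
  (0 < n)%N /\
  (forall i, arc_param (e i)) /\
  \bigcup_(i in [set: 'I_n]) arc_of (e i) = [set: X] /\
  (forall i j, i != j ->
     arc_of (e i) `&` arc_of (e j) `<=` endpoints (e i) `&` endpoints (e j)).

Definition topological_graph (X : pseudoMetricType R) (n : nat)
  (e : 'I_n -> R -> X) : Prop :=
  hausdorff_space X /\ compact [set: X] /\ connected [set: X] /\
  graph_edges e.

Definition is_vertex (X : topologicalType) (n : nat) (e : 'I_n -> R -> X)
  (v : X) : Prop := exists i, endpoints (e i) v.

Definition degree (X : topologicalType) (n : nat) (e : 'I_n -> R -> X)
  (v : X) : nat := (\sum_(i < n) (asbool (endpoints (e i) v) : nat))%N.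

Definition circle : set (R * R) := [set p | p.1 ^+ 2 + p.2 ^+ 2 = 1].

Definition homeomorphic_to_circle (X : topologicalType) : Prop :=
  exists (f : X -> R * R) (g : R * R -> X),
    continuous f /\ (forall x, circle (f x)) /\
    {within circle, continuous g} /\
    (forall x, g (f x) = x) /\ (forall p, circle p -> f (g p) = p).
End Defs.

Definition is_homeo (X : topologicalType) (f : X -> X) : Prop :=
  exists g : X -> X, continuous f /\ continuous g /\ cancel f g /\ cancel g f.

Definition homeo_subgroup (X : topologicalType) (G : set (X -> X)) : Prop :=
  G `<=` [set f | is_homeo f] /\
  G id /\
  (forall f g, G f -> G g -> G (f \o g)) /\
  (forall f, G f -> exists g, G g /\ cancel f g /\ cancel g f).

Definition invariant (X : topologicalType) (G : set (X -> X)) (Y : set X) : Prop :=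
  Y !=set0 /\ (forall g y, G g -> Y y -> Y (g y)).

Definition inv_chain (X : topologicalType) (G : set (X -> X)) (k : nat) : Prop :=
  exists Y : nat -> set X,
    (forall i, (i <= k)%N -> closed (Y i) /\ invariant G (Y i)) /\
    (forall i, (i < k)%N -> Y i `<` Y i.+1) /\
    Y k = [set: X].

Definition height (R : realType) (X : topologicalType) (G : set (X -> X))
  : \bar R :=
  ereal_sup [set ((k%:R : R)%:E) | k in [set k | inv_chain G k]].

Definition P_h (R : realType) (X : topologicalType) : set (\bar R) :=
  [set height R G | G in [set G : set (X -> X) | homeo_subgroup G]].
Arguments P_h R X : clear implicits.
Arguments height R {X} G.
Arguments homeomorphic_to_circle R X : clear implicits.

(* Main.v *)
(* On the circle the trivial group has infinite height, the rotations height 0,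
   and for k > 0 the homeomorphisms preserving the vertices and edges of a k-gon
   modulo a reflection have k + 1 orbits, which can be added one at a time
   through closed sets, so that the height is k.

   Conversely the points without a neighbourhood homeomorphic to an open interval
   form a closed invariant set missing the interiors of edges; if the height is 0
   this set is empty, and the intermediate value theorem then forces exactly two
   edges at each vertex, one on either side of it in a chart.

   If all degrees are 2, walk along the edges, leaving each vertex by the other
   edge.  The walk is periodic and never traverses an edge twice within a period;
   by connectedness it covers the graph, and sending its k-th edge to the k-th arc
   of a subdivided circle is a homeomorphism by compactness. *)
Require Import Defs.
From HB Require Import structures.
From mathcomp Require Import all_boot all_order all_algebra.
From mathcomp Require Import all_classical all_reals all_analysis.
From mathcomp Require Import ring lra zify.
Import Order.TTheory GRing.Theory Num.Theory.
Import numFieldNormedType.Exports.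
Set Implicit Arguments. Unset Strict Implicit. Unset Printing Implicit Defensive.
Local Open Scope classical_set_scope.
Local Open Scope ring_scope.

(** * Closed maps and the angle parametrization *)

Section Topology.

Lemma continuous_within_comp (S T U : topologicalType) (A : set S) (B : set T)
    (f : S -> T) (g : T -> U) :
  {within A, continuous f} -> {within B, continuous g} -> f @` A `<=` B ->
  {within A, continuous (g \o f)}.
Proof.
move=> cf cg fAB; apply/continuous_closedP => W cW.
have /closed_subspaceP[V cV VW] := (continuous_closedP _).1 cg _ cW.
have /closed_subspaceP[Z cZ ZV] := (continuous_closedP _).1 cf _ cV.
apply/closed_subspaceP; exists Z => //; rewrite ZV.
apply/seteqP; split=> x [fx Ax]; split=> //.
  by have [] : (from_subspace B g @^-1` W `&` B) (f x)
    by rewrite -VW; split=> //; apply: fAB; exists x.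
by have [] : (V `&` B) (f x) by rewrite VW; split=> //; apply: fAB; exists x.
Qed.

Lemma within_setT_continuous (T U : topologicalType) (f : T -> U) :
  {within [set: T], continuous f} -> continuous f.
Proof. by move=> cf x; have := cf x; rewrite /continuous_at nbhs_subspaceT. Qed.

(* A continuous map from a compact set to a Hausdorff space is closed, hence a
   quotient map onto its image. *)
Lemma continuous_factor (K : topologicalType) (Y Z : topologicalType) (A : set K)
    (q : K -> Y) (F : Y -> Z) :
  compact A -> hausdorff_space Y -> {within A, continuous q} ->
  {within A, continuous (F \o q)} -> {within q @` A, continuous F}.
Proof.
move=> cA hY cq cFq; apply/continuous_closedP => W cW.
have /closed_subspaceP[V cV VW] := (continuous_closedP _).1 cFq _ cW.
apply/closed_subspaceP; exists (q @` (V `&` A)).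
  apply: compact_closed => //; apply: continuous_compact.
    by apply: continuous_subspaceW cq => x [].
  by rewrite setIC; apply: compact_closedI.
apply/seteqP; split=> [y [[x] + <- _]|y [Wy [x Ax qxy]]].
  by rewrite VW => -[Wx Ax]; split=> //; exists x.
split; last by exists x.
by exists x => //; rewrite VW; split=> //; rewrite /from_subspace/= qxy.
Qed.

Lemma finite_pasting (I : finType) (T U : topologicalType) (A : I -> set T)
    (f : T -> U) :
  (forall i, closed (A i)) -> (forall i, {within A i, continuous f}) ->
  (forall x, exists i, A i x) -> continuous f.
Proof.
move=> cA cf cover; apply/continuous_closedP => W cW.
have -> : f @^-1` W = \bigcup_(i in [set: I]) (f @^-1` W `&` A i).
  apply/seteqP; split=> [x Wx|x [i _ []]//].
  by have [i Aix] := cover x; exists i.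
apply: closed_bigcup => [|i _]; first exact: finite_finset.
have /closed_subspaceP[V cV VW] := (continuous_closedP _).1 (cf i) _ cW.
by rewrite -[X in closed (X `&` _)]/(from_subspace (A i) f @^-1` W) -VW; apply: closedI.
Qed.

End Topology.

(** * The circle as an interval with its ends identified *)

Section AngleParametrization.
Variable R : realType.

Definition angle (t : R) : R * R := (cos (pi *+ 2 * t), sin (pi *+ 2 * t)).

Lemma angle_circle t : circle (angle t).
Proof. exact: cos2Dsin2. Qed.

Lemma continuous_angle : continuous angle.
Proof.
move=> t; apply: (@cvg_pair _ _ _ _ (nbhs (cos _)) (nbhs (sin _))) => /=.
  by apply: (continuous_comp _ (@continuous_cos R _)); apply: mulrl_continuous.
by apply: (continuous_comp _ (@continuous_sin R _)); apply: mulrl_continuous.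
Qed.

Lemma angleD1 t : angle (t + 1) = angle t.
Proof. by rewrite /angle mulrDr mulr1 cosD2pi sinD2pi. Qed.

Let pi2_gt0 : 0 < pi *+ 2 :> R.
Proof. by rewrite pmulrn_lgt0// pi_gt0. Qed.

Let lt_pi_sin_lt0 (x : R) : pi < x < pi *+ 2 -> sin x < 0.
Proof.
move=> /andP[x1 x2]; rewrite -oppr_gt0 -(subrK pi x) sinDpi opprK.
apply: sin_gt0_pi; apply/andP; split; first by lra.
by rewrite mulr2n in x2; lra.
Qed.

(** The cosine is injective on [0, pi], the sign of the sine separates the two half turns, and a
    shift by pi reduces the second half turn to the first. *)
Lemma angle_inj s t : 0 <= s < 1 -> 0 <= t < 1 -> angle s = angle t -> s = t.
Proof.
have key (x y : R) : 0 <= x < pi *+ 2 -> 0 <= y < pi *+ 2 ->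
    cos x = cos y -> sin x = sin y -> x = y.
  wlog xy : x y / x <= y.
    move=> H hx hy cxy sxy; have [xy|/ltW yx] := leP x y; first exact: H.
    exact/esym/H.
  move=> /andP[x0 x2] /andP[y0 y2] cxy sxy.
  have [ypi|ypi] := leP y pi.
    apply: cos_inj cxy; rewrite in_itv /= ?x0 ?y0 //= (le_trans xy)//.
  have xpi : pi < x.
    have [|//] := leP x pi; move=> xpi.
    have := sin_ge0_pi (x := x); rewrite x0 xpi => /(_ erefl).
    by rewrite sxy leNgt lt_pi_sin_lt0// ypi y2.
  have : x - pi = y - pi; last by lra.
  apply: cos_inj.
  - by rewrite in_itv /=; apply/andP; split; move: x2; rewrite mulr2n; lra.
  - by rewrite in_itv /=; apply/andP; split; move: y2; rewrite mulr2n; lra.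
  - apply: oppr_inj; rewrite -!cosDpi !subrK; exact: cxy.
move=> /andP[s0 s1] /andP[t0 t1] [cst sst].
have : pi *+ 2 * s = pi *+ 2 * t.
  by apply: key => //; rewrite ?mulr_ge0 ?(ltW pi2_gt0)//= gtr_pMr.
by apply: mulfI; rewrite gt_eqF.
Qed.

Lemma angle_surj p : circle p -> exists2 t, 0 <= t < 1 & angle t = p.
Proof.
case: p => x y; rewrite /circle /= => xy1.
have x1 : -1 <= x <= 1.
  rewrite -ler_norml -(@ler_pXn2r _ 2) ?nnegrE// real_normK ?num_real// expr1n.
  by rewrite -xy1 lerDl sqr_ge0.
have acosE : sin (acos x) = `|y|.
  rewrite sin_acos// (_ : 1 - x ^+ 2 = y ^+ 2) ?sqrtr_sqr//; lra.
have a0 := acos_ge0 x1; have api := acos_lepi x1.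
have cosE : cos (acos x) = x by rewrite acosK// in_itv.
have [y0|y0] := leP 0 y.
  exists (acos x / (pi *+ 2)).
    rewrite divr_ge0 ?(ltW pi2_gt0)//= ltr_pdivrMr// mul1r.
    by rewrite (le_lt_trans api)// mulr2n ltrDl pi_gt0.
  rewrite /angle mulrC divfK ?gt_eqF//.
  by rewrite cosE acosE ger0_norm.
(* [acos] only reaches the upper half circle, so the angle is reflected. The parameter stays below 1
   because [acos x = 0] would force [y = 0]. *)
exists ((pi *+ 2 - acos x) / (pi *+ 2)).
  rewrite divr_ge0 ?(ltW pi2_gt0)//=.
    rewrite ltr_pdivrMr// mul1r ltrBlDr ltrDl lt_neqAle a0 andbT.
    apply/eqP => a00; move: acosE; rewrite -a00 sin0 => /esym/eqP.
    by rewrite normr_eq0 lt_eqF.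
  by rewrite subr_ge0 (le_trans api)// mulr2n lerDl pi_ge0.
rewrite /angle mulrC divfK ?gt_eqF//.
rewrite -[in RHS]cosE addrC cosD2pi sinD2pi cosN sinN acosE ltr0_norm//.
by rewrite opprK.
Qed.

End AngleParametrization.

(** * Heights *)

Section Height.
Variables (R : realType) (X : topologicalType).
Implicit Type G : set (X -> X).

Lemma is_homeo_id : is_homeo (@id X).
Proof. by exists id; split; [|split]=> // x; exact: cvg_id. Qed.

Lemma is_homeo_comp (f g : X -> X) : is_homeo f -> is_homeo g -> is_homeo (f \o g).
Proof.
move=> [f' [cf [cf' [fK f'K]]]] [g' [cg [cg' [gK g'K]]]]; exists (g' \o f').
split; first by move=> x; apply: continuous_comp; [exact: cg|exact: cf].
split; first by move=> x; apply: continuous_comp; [exact: cf'|exact: cg'].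
by split; apply: can_comp.
Qed.

Lemma inv_chain0 G : [set: X] !=set0 -> inv_chain G 0.
Proof.
move=> X0; exists (fun=> setT); split=> [i _|]; last by split.
by split; [exact: closedT|split].
Qed.

Lemma height_max G k : inv_chain G k ->
  (forall m, inv_chain G m -> (m <= k)%N) -> height R G = k%:R%:E.
Proof.
move=> Gk maxk; apply/eqP; rewrite eq_le; apply/andP; split.
  by apply: ge_ereal_sup => _ [m Gm <-]; rewrite lee_fin ler_nat maxk.
by apply: ereal_sup_ubound; exists k.
Qed.

Lemma height_infinite G : (forall k, exists2 m, inv_chain G m & (k <= m)%N) ->
  height R G = +oo%E.
Proof.
move=> Gk; apply/eqyP => A A0.
have [m Gm km] := Gk (Num.truncn A).+1.
apply: (@le_trans _ _ m%:R%:E).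
  rewrite lee_fin; apply/ltW/(lt_le_trans (truncnS_gt A)).
  by rewrite ler_nat.
by apply: ereal_sup_ubound; exists m.
Qed.

(** A bounded set of chain lengths has a maximum, which is the height; an unbounded one has supremum
    [+oo]. *)
Lemma height_cases G : [set: X] !=set0 ->
  (range (fun k : nat => (k%:R : R)%:E) `|` [set +oo%E]) (height R G).
Proof.
move=> X0.
have [[b Gb]|nb] := pselect (exists b, forall m, inv_chain G m -> (m <= b)%N).
  have ex0 : exists m, `[< inv_chain G m >] by exists 0; apply/asboolP/inv_chain0.
  have Gb' m : `[< inv_chain G m >] -> (m <= b)%N by move/asboolP/Gb.
  have [k /asboolP Gk maxk] := ex_maxnP ex0 Gb'.
  left; exists k => //; apply/esym/height_max => // m Gm.
  by apply: maxk; apply/asboolP.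
right; apply: height_infinite => k; apply: contrapT => Gk; apply: nb.
exists k => m Gm; rewrite leqNgt; apply/negP => km.
by apply: Gk; exists m => //; exact: ltnW.
Qed.

(** The group consists of all homeomorphisms preserving every [C i]. By transitivity its orbits are
    [C 0] and the [k] differences of consecutive terms. The chain [C] gives height at least [k];
    conversely invariant sets are unions of these [k + 1] orbits, so no chain is longer. *)
Lemma P_h_transitive_chain (C : nat -> set X) k :
  (forall i, (i <= k)%N -> closed (C i)) ->
  (forall i, (i < k)%N -> C i `<` C i.+1) ->
  C k = [set: X] -> C 0 !=set0 ->
  (forall x y, (forall i, (i <= k)%N -> C i x <-> C i y) ->
    exists f, [/\ is_homeo f, f x = y &
      forall i z, (i <= k)%N -> C i (f z) <-> C i z]) ->
  P_h R X (k%:R%:E).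
Proof.
move=> clC ltC CT C0 tr.
pose G : set (X -> X) := [set f | is_homeo f /\
  forall i z, (i <= k)%N -> C i (f z) <-> C i z].
have monoC i j : (i <= j)%N -> (j <= k)%N -> C i `<=` C j.
  elim: j => [|j IH]; first by rewrite leqn0 => /eqP -> _ x.
  rewrite leq_eqVlt => /predU1P[-> _ //|ij jk x Cix].
  by apply: (ltC _ jk).1; exact: (IH ij (ltnW jk) x Cix).
have C_neq0 i : (i <= k)%N -> C i !=set0.
  by move=> ik; have [x C0x] := C0; exists x; apply: monoC C0x.
exists G.
  split; first by move=> f [].
  split; first by split=> //; exact: is_homeo_id.
  split=> [f g [hf fC] [hg gC]|f].
    by split=> [|i z ik]; [exact: is_homeo_comp|rewrite /= fC// gC].
  move=> [[f' [cf [cf' [fK f'K]]]] fC]; exists f'; split=> //.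
  split; first by exists f.
  by move=> i z ik; rewrite -fC// f'K.
apply: height_max.
  exists C; split=> // i ik; split; first exact: clC.
  by split; [exact: C_neq0|move=> g y [_ gC] /(gC _ _ ik)].
move=> m [Y [clY [ltY YT]]].
(* One representative is chosen in each orbit, that is, in [C j] but in no earlier term. *)
have rep_ex (j : 'I_k.+1) : exists x, C j x /\ forall l, (l < j)%N -> ~ C l x.
  case: j => -[|j] /= jk; first by have [x] := C0; exists x.
  have [_ /existsNP[x /not_implyP[Cjx nCjx]]] := ltC j jk.
  by exists x; split=> // l lj Clx; apply: nCjx; apply: monoC Clx => //; exact: ltnW.
have [x xP] := choice rep_ex.
have inv_class i y z : (i <= m)%N -> (forall l, (l <= k)%N -> C l y <-> C l z) ->
    Y i y -> Y i z.
  move=> im /tr[f [hf <- fC]] Yy; have [_ [_ Yinv]] := clY i im.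
  exact: Yinv.
(* The orbit of [y] is determined by the least [j] with [y] in [C j]. *)
have classP y : exists j : 'I_k.+1, forall l, (l <= k)%N -> C l y <-> C l (x j).
  have exj : exists j, (j <= k)%N && `[< C j y >].
    by exists k; rewrite leqnn; apply/asboolP; rewrite CT.
  have [j /andP[jk /asboolP Cjy] minj] := ex_minnP exj.
  have jk' : (j < k.+1)%N by [].
  exists (Ordinal jk') => l lk; have [/= Cjx nCx] := xP (Ordinal jk').
  split=> [Cly|Clx].
    have jl : (j <= l)%N by apply: minj; rewrite lk; apply/asboolP.
    exact: monoC Cjx.
  have jl : (j <= l)%N by rewrite leqNgt; apply/negP => /nCx.
  exact: monoC Cjy.
(* The orbits contained in [Y i]: there is at least one for [i = 0], and their number grows at each
   step of the chain but cannot exceed [k + 1]. *)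
pose S i := [set j : 'I_k.+1 | `[< Y i (x j) >]]%SET.
have cardS i : (i <= m)%N -> (i < #|S i|)%N.
  elim: i => [|i IH] im.
    have [_ [[y Yy] _]] := clY 0%N im; have [j yj] := classP y.
    by apply/card_gt0P; exists j; rewrite inE; apply/asboolP/(inv_class _ y).
  apply: leq_ltn_trans (IH (ltnW im)) _; apply: proper_card.
  have [Yi /existsNP[y /not_implyP[Yy nYy]]] := ltY i im.
  apply/properP; split.
    by apply/fintype.subsetP => j; rewrite !inE; exact: Yi.
  have [j yj] := classP y; exists j; rewrite inE.
    by apply/asboolP/(inv_class _ y).
  apply/asboolP => Yj; apply: nYy; apply: (inv_class _ (x j)) => //.
    exact: ltnW.
  by move=> l lk; rewrite yj.
by rewrite -ltnS -[k.+1]card_ord; apply: leq_trans (cardS m (leqnn _)) (max_card _).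
Qed.

(** Under the trivial group every nonempty set is invariant, so finite initial segments of the
    sequence give chains of any length; the last term is replaced by the whole space, where a chain
    must end. *)
Lemma P_h_infinite (a : nat -> X) : hausdorff_space X -> injective a ->
  P_h R X +oo%E.
Proof.
move=> hX inja.
exists [set id].
  split; first by move=> _ ->; exact: is_homeo_id.
  split=> //; split; first by move=> _ _ -> ->.
  by move=> _ ->; exists id.
apply: height_infinite => k; exists k => //.
exists (fun i => if i == k then setT else a @` `I_i.+1); split.
  move=> i ik; split; last first.
    split; last by move=> _ y ->.
    case: ifP => _; first by exists (a 0%N).
    by exists (a 0%N), 0%N.
  case: ifP => _; first exact: closedT.
  apply: (accessible_finite_set_closed.1 (hausdorff_accessible hX)).
  by apply: finite_image; exact: finite_II.
rewrite eqxx; split=> // i ik; rewrite (ltn_eqF ik).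
split.
  case: ifP => _ // _ [j /= ji <-]; exists j => //=; exact: ltnW.
move=> /(_ (a i.+1)); case: ifP => _ H.
  by have [//|j /= ji /inja jE] := H; move: ji; rewrite jE ltnn.
have [|j /= ji /inja jE] := H; first by exists i.+1 => /=.
by move: ji; rewrite jE ltnn.
Qed.

End Height.

(** * Groups acting on a closed curve *)

Lemma continuous_bij_homeo (X : topologicalType) (f g : X -> X) :
  compact [set: X] -> hausdorff_space X -> continuous f ->
  cancel f g -> cancel g f -> is_homeo f.
Proof.
move=> cX hX cf fK gK; exists g; split=> //; split; last by split.
apply: within_setT_continuous.
have -> : [set: X] = f @` setT.
  by apply/seteqP; split=> // x _; exists (g x).
apply: continuous_factor => //; first exact: continuous_subspaceT.
apply: continuous_subspaceT; have -> : g \o f = idfun by apply/funext.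
by move=> x; exact: cvg_id.
Qed.

Section MovePoint.
Variable R : realType.

(* Piecewise linear homeomorphism of [a, b] with one breakpoint, extended by
   the identity; a lattice expression in increasing affine maps is at once
   continuous and increasing. *)
Lemma exists_moving_map (a b s t : R) : a < s < b -> a < t < b ->
  exists h : R -> R, [/\ continuous h, {homo h : x y / x < y}, h s = t &
    forall z, ~~ (a < z < b) -> h z = z].
Proof.
move=> /andP[as_ sb] /andP[at_ tb].
pose al := (t - a) / (s - a); pose be := (b - t) / (b - s).
have al0 : 0 < al by rewrite divr_gt0 ?subr_gt0.
have be0 : 0 < be by rewrite divr_gt0 ?subr_gt0.
have sa0 : s - a != 0 by rewrite subr_eq0 gt_eqF.
have bs0 : b - s != 0 by rewrite subr_eq0 gt_eqF.
have alE : al * (s - a) = t - a by rewrite divfK.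
have beE : be * (b - s) = b - t by rewrite divfK.
(* The affine maps through (a, a), (s, t) and through (s, t), (b, b). *)
pose L1 z := a + al * (z - a); pose L2 z := b - be * (b - z).
have L1lt x y : x < y -> L1 x < L1 y.
  by move=> xy; rewrite /L1 ltrD2l ltr_pM2l// ltrD2r.
have L2lt x y : x < y -> L2 x < L2 y.
  by move=> xy; rewrite /L2 ltrD2l ltrN2 ltr_pM2l// ltrD2l ltrN2.
have cL1 : continuous L1.
  move=> z; apply: cvgD; first exact: cvg_cst.
  by apply: cvgMl_tmp; apply: cvgB; [exact: cvg_id|exact: cvg_cst].
have cL2 : continuous L2.
  move=> z; apply: cvgB; first exact: cvg_cst.
  by apply: cvgMl_tmp; apply: cvgB; [exact: cvg_cst|exact: cvg_id].
have L1s : L1 s = t by rewrite /L1 alE addrC subrK.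
have L2s : L2 s = t by rewrite /L2 beE opprB addrC subrK.
(* If [s <= t], the slopes satisfy [be <= 1 <= al], so the minimum of [L1] and [L2] lies above the
   identity on [a, b] and below it outside; the maximum with the identity cuts it off there. The
   other case is dual. *)
have [st|ts] := leP s t.
  have al1 : 1 <= al by rewrite ler_pdivlMr ?subr_gt0// mul1r lerD2r.
  have be1 : be <= 1 by rewrite ler_pdivrMr ?subr_gt0// mul1r lerD2l lerN2.
  exists (fun z => Num.max z (Num.min (L1 z) (L2 z))); split.
  - move=> z; apply: (@continuous_max _ _ (fun z => z) (fun z => Num.min (L1 z) (L2 z))).
      exact: cvg_id.
    by apply: (@continuous_min _ _ L1 L2); [exact: cL1|exact: cL2].
  - move=> x y xy; have := L1lt _ _ xy; have := L2lt _ _ xy => H1 H2.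
    have H : Num.min (L1 x) (L2 x) < Num.min (L1 y) (L2 y).
      by rewrite lt_min !gt_min H1 H2 orbT.
    by rewrite gt_max !lt_max xy H orbT.
  - by rewrite L1s L2s minxx max_r.
  - move=> z; rewrite negb_and -!leNgt => /orP[za|bz].
      apply/max_idPl; rewrite ge_min; apply/orP; left.
      by rewrite /L1; nra.
    apply/max_idPl; rewrite ge_min; apply/orP; right.
    by rewrite /L2; nra.
have al1 : al <= 1 by rewrite ler_pdivrMr ?subr_gt0// mul1r lerD2r ltW.
have be1 : 1 <= be by rewrite ler_pdivlMr ?subr_gt0// mul1r lerD2l lerN2 ltW.
exists (fun z => Num.min z (Num.max (L1 z) (L2 z))); split.
- move=> z; apply: (@continuous_min _ _ (fun z => z) (fun z => Num.max (L1 z) (L2 z))).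
    exact: cvg_id.
  by apply: (@continuous_max _ _ L1 L2); [exact: cL1|exact: cL2].
- move=> x y xy; have := L1lt _ _ xy; have := L2lt _ _ xy => H1 H2.
  have H : Num.max (L1 x) (L2 x) < Num.max (L1 y) (L2 y).
    by rewrite gt_max !lt_max H1 H2 orbT.
  by rewrite lt_min !gt_min xy H orbT.
- by rewrite L1s L2s maxxx min_r// ltW.
- move=> z; rewrite negb_and -!leNgt => /orP[za|bz].
    apply/min_idPl; rewrite le_max; apply/orP; left.
    by rewrite /L1; nra.
  apply/min_idPl; rewrite le_max; apply/orP; right.
  by rewrite /L2; nra.
Qed.

End MovePoint.

(** * Homeomorphisms and invariant cells of a closed curve *)

Section ClosedCurve.
Variables (R : realType) (X : topologicalType) (p : R -> X).
Hypotheses (hX : hausdorff_space X) (cp : continuous p).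
Hypothesis p_inj : forall s t, 0 <= s < 1 -> 0 <= t < 1 -> p s = p t -> s = t.
Hypothesis p_surj : forall x, exists2 t, 0 <= t < 1 & p t = x.
Hypothesis p01 : p 1 = p 0.

Let I01 : set R := `[0, 1].

Let p_image : p @` I01 = [set: X].
Proof.
apply/seteqP; split=> // x _; have [t /andP[t0 t1] <-] := p_surj x.
by exists t => //; rewrite /I01/= in_itv/= t0 ltW.
Qed.

Lemma curve_compact : compact [set: X].
Proof.
rewrite -p_image; apply: continuous_compact (@segment_compact _ _ _).
exact: continuous_subspaceT.
Qed.

(** By compactness [p] makes the space a quotient of [0, 1], so continuity can be tested on
    parameters. *)
Lemma curve_factor_continuous (Z : topologicalType) (F : X -> Z) :
  {within I01, continuous (F \o p)} -> continuous F.
Proof.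
move=> cF; apply: within_setT_continuous; rewrite -p_image.
apply: continuous_factor => //; first exact: segment_compact.
exact: continuous_subspaceT.
Qed.

(** A set-theoretic inverse of [p] with values in [0, 1). It jumps at the base point, whose
    parameter is 0 and not 1. *)
Lemma curve_param : exists s : X -> R,
  [/\ forall x, 0 <= s x < 1, cancel s p,
      forall t, 0 <= t < 1 -> s (p t) = t & s (p 1) = 0].
Proof.
have sP x : exists t, 0 <= t < 1 /\ p t = x.
  by have [t ? ?] := p_surj x; exists t.
have [s {}sP] := choice sP; exists s; split.
- by move=> x; have [] := sP x.
- by move=> x; have [] := sP x.
- by move=> t t01; have [? ?] := sP (p t); exact: p_inj.
- by have [? ?] := sP (p 1); apply: p_inj => //; rewrite ?lexx ?ltr01// -p01.
Qed.

Lemma curve_induced_map (h : R -> R) : continuous h -> p (h 0) = p (h 1) ->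
  exists2 F : X -> X, continuous F & forall t, I01 t -> F (p t) = p (h t).
Proof.
move=> ch h01; have [s [s01 sK pK p1]] := curve_param.
have FE t : I01 t -> p (h (s (p t))) = p (h t).
  rewrite /I01/= in_itv/= => /andP[t0]; rewrite le_eqVlt => /predU1P[->|t1].
    by rewrite p1.
  by rewrite pK// t0.
exists (p \o h \o s) => //; apply: curve_factor_continuous.
apply: (@subspace_eq_continuous _ _ _ (p \o h)).
  by move=> t /[!inE] /FE.
by apply: continuous_subspaceT => t; apply: continuous_comp; [exact: ch|exact: cp].
Qed.

Lemma curve_increasing_homeo (h : R -> R) : continuous h ->
  {homo h : x y / x < y} -> h 0 = 0 -> h 1 = 1 ->
  exists2 F : X -> X, is_homeo F & forall t, I01 t -> F (p t) = p (h t).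
Proof.
move=> ch hlt h0 h1; have hle := ltW_homo hlt.
have [|F cF FE] := curve_induced_map ch; first by rewrite h0 h1 p01.
have hinj : injective h.
  by move=> x y; have [/hlt|/hlt|//] := ltgtP x y => /lt_eqF/eqP // + /esym.
have h01 t : 0 <= t < 1 -> 0 <= h t < 1.
  by move=> /andP[t0 t1]; rewrite -[leLHS]h0 -[ltRHS]h1 hle//= hlt.
have [s [s01 sK pK p1]] := curve_param.
have in01 t : 0 <= t < 1 -> I01 t.
  by move=> /andP[t0 t1]; rewrite /I01/= in_itv/= t0 ltW.
(* Surjectivity comes from the intermediate value theorem; the value 1 of the parameter is excluded
   because [h 1 = 1] while [s y < 1]. *)
have /choice[g gP] y : exists t, 0 <= t < 1 /\ h t = s y.
  have /andP[sy0 sy1] := s01 y.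
  have [||t] := @IVT R h 0 1 (s y) ler01.
  - exact: continuous_subspaceT.
  - by rewrite h0 h1 min_l ?max_r ?sy0 ?ler01//= ltW.
  rewrite in_itv/= => /andP[t0]; rewrite le_eqVlt => /predU1P[-> h1E|t1 hE].
    by move: sy1; rewrite -h1E h1 ltxx.
  by exists t; rewrite t0.
exists F => //.
apply: (@continuous_bij_homeo _ F (p \o g)) => //; first exact: curve_compact.
- move=> x; rewrite /= -(sK x); have [g01 gE] := gP (F (p (s x))).
  congr p; apply: hinj; rewrite gE FE ?pK//; first exact: h01.
  exact: in01.
- move=> y; have [g01 gE] := gP y.
  by rewrite /= FE ?gE ?sK//; exact: in01.
Qed.

Lemma curve_reflection : exists2 F : X -> X, is_homeo F &
  forall t, I01 t -> F (p t) = p (1 - t).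
Proof.
have [||F cF FE] := @curve_induced_map (fun t => 1 - t).
- by move=> t; apply: cvgB; [exact: cvg_cst|exact: cvg_id].
- by rewrite subr0 subrr p01.
exists F => //; have FK : cancel F F.
  move=> x; have [t /andP[t0 t1] <-] := p_surj x.
  rewrite !FE ?subKr//= /I01/= in_itv/= ?t0 ?(ltW t1)//.
  by rewrite subr_ge0 gerBl t0 ltW.
by exists F.
Qed.

(** The function [u] is the coordinate on the quotient by the reflection. It is continuous across
    the base point because its formula vanishes at both ends. *)
Lemma curve_depth : exists u : X -> R, [/\ continuous u,
  forall t, I01 t -> u (p t) = Num.min t (1 - t) &
  forall x, 0 <= u x <= 2^-1].
Proof.
have [s [s01 sK pK p1]] := curve_param.
pose u x := Num.min (s x) (1 - s x).
have uE t : I01 t -> u (p t) = Num.min t (1 - t).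
  rewrite /I01/= in_itv/= => /andP[t0]; rewrite le_eqVlt => /predU1P[->|t1].
    by rewrite /u p1 subrr subr0 minC.
  by rewrite /u pK// t0.
exists u; split=> //.
  apply: curve_factor_continuous.
  have cmin : continuous (fun t : R => Num.min t (1 - t) : R).
    move=> t; apply: (@continuous_min _ _ (fun t => t) (fun t => 1 - t)).
      exact: cvg_id.
    by apply: cvgB; [exact: cvg_cst|exact: cvg_id].
  apply: (subspace_eq_continuous _ (continuous_subspaceT cmin)).
  by move=> t /[!inE] /uE.
move=> x; have /andP[s0 s1] := s01 x; rewrite /u le_min ge_min s0 subr_ge0 ltW//=.
by apply/orP; case: (leP (s x) 2^-1) => H; [left|right; lra].
Qed.

(* The k-gon with vertices p (i / k), up to the reflection t |-> 1 - t, has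
   k + 1 cells: vertices at even values of [w], edges in between.  The cells are
   added in the order v_0, v_1, e_0, v_2, e_1, ... *)
Let cell_chain (k : nat) (w : R) (j : nat) : Prop :=
  j = k \/ w <= j./2%:R \/ odd j /\ w = j./2.+1%:R.

Let cell_chain_open k w w' (i j : nat) :
  i%:R < w < i.+1%:R -> i%:R < w' < i.+1%:R ->
  cell_chain k w j -> cell_chain k w' j.
Proof.
move=> /andP[iw wi] /andP[iw' wi'] [->|[wj|[oj wE]]]; first by left.
  right; left; apply/ltW/(lt_le_trans wi').
  by rewrite ler_nat -(ltr_nat R) (lt_le_trans iw).
by move: iw wi; rewrite wE !ltr_nat => ? ?; lia.
Qed.

(** With [i] the integer part of [w], level [2i] excludes [w = i], level [2i + 1] excludes
    [w' = i + 1], and level [2i + 2] excludes [w' > i + 1]. The bound [w' <= k / 2] keeps each level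
    used from being the full level [k]. *)
Let cell_chain_sep k w w' : w <= w' -> w' <= k%:R / 2 -> 0 <= w -> w <> w' ->
  (forall j, (j <= k)%N -> cell_chain k w j <-> cell_chain k w' j) ->
  exists i : nat, i%:R < w < i.+1%:R /\ i%:R < w' < i.+1%:R.
Proof.
move=> le_ww' w'k w0 /eqP neq_ww' Cww'.
have lt_ww' : w < w' by rewrite lt_neqAle neq_ww'.
have [i /andP[iw wi]] : exists i : nat, i%:R <= w < i.+1%:R.
  by exists (Num.truncn w); exact: truncn_itv.
have k2 (a : nat) : a%:R < w' -> (a.*2 < k)%N.
  move=> aw; rewrite -(ltr_nat R) -muln2 natrM -ltr_pdivlMr//.
  exact: lt_le_trans w'k.
have iw' : i%:R < w' by exact: le_lt_trans lt_ww'.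
have {}iw : i%:R < w.
  rewrite lt_neqAle iw andbT; apply/eqP => iE.
  have [+ _] := Cww' i.*2 (ltnW (k2 _ iw')).
  case; first by right; left; rewrite doubleK -iE.
    by move=> i2; have := k2 _ iw'; rewrite -i2 ltnn.
  case=> [|[]]; last by rewrite odd_double.
  by rewrite doubleK leNgt iw'.
exists i; rewrite iw wi iw'; split=> //=.
rewrite ltNge; apply/negP; rewrite le_eqVlt => /predU1P[wE|].
  have k2' := k2 _ iw'.
  have [_] := Cww' i.*2.+1 k2'.
  case.
  - by right; right; rewrite /= odd_double uphalf_double wE.
  - move=> kE; have := w'k; rewrite -wE -kE ler_pdivlMr// -natrM ler_nat; lia.
  - rewrite /= odd_double uphalf_double; case.
      by rewrite leNgt iw.
    by case=> _ wE'; move: wi; rewrite wE' ltxx.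
move=> i1w'; have := k2 _ i1w' => k2'.
have [+ _] := Cww' i.+1.*2 (ltnW k2').
case; first by right; left; rewrite doubleK ltW.
  by move=> i2; move: k2'; rewrite -i2 ltnn.
case=> [|[]]; last by rewrite odd_double.
by rewrite doubleK leNgt i1w'.
Qed.

(** Two points in the same members of the chain are joined in three moves: fold the first into the
    lower half by the reflection, slide it within its open edge, and unfold onto the second. *)
Lemma P_h_curve (k : nat) : (0 < k)%N -> P_h R X (k%:R%:E).
Proof.
move=> k0; have kR0 : 0 < k%:R :> R by rewrite ltr0n.
have [u [cu uE u12]] := curve_depth.
have [rho hrho rhoE] := curve_reflection.
pose w x := k%:R * u x.
have cw : continuous w.
  by move=> x; apply: cvgMl_tmp; exact: cu.
have wk x : w x <= k%:R / 2 by rewrite ler_pM2l//; have /andP[] := u12 x.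
have w0 x : 0 <= w x by rewrite mulr_ge0//; have /andP[] := u12 x.
have w_surj v : 0 <= v <= k%:R / 2 -> exists x, w x = v.
  move=> /andP[v0 vk]; exists (p (v / k%:R)).
  have v2 : v / k%:R <= 2^-1 by rewrite ler_pdivrMr// mulrC.
  have v0' : 0 <= v / k%:R by rewrite divr_ge0.
  have vE : k%:R * (v / k%:R) = v by rewrite mulrC divfK// gt_eqF.
  rewrite /w; move: (v / k%:R) v2 v0' vE => q q2 q0 qE.
  rewrite uE; last by rewrite /I01/= in_itv/= q0/=; lra.
  by rewrite min_l//; lra.
have w_rho x : w (rho x) = w x.
  have [t /andP[t0 t1] <-] := p_surj x.
  have t01 : I01 t by rewrite /I01/= in_itv/= t0 ltW.
  have t01' : I01 (1 - t) by rewrite /I01/= in_itv/= subr_ge0 (ltW t1) gerBl.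
  by rewrite rhoE// /w !uE// subKr minC.
pose C (j : nat) : set X := [set x | cell_chain k (w x) j].
pose pres f := is_homeo f /\ forall j z, C j (f z) <-> C j z.
have presM f g : pres f -> pres g -> pres (f \o g).
  move=> [hf fC] [hg gC]; split=> [|j z]; first exact: is_homeo_comp.
  by rewrite /= fC gC.
have pres_id : pres id by split=> //; exact: is_homeo_id.
(* The map [r] is the identity or the reflection, and exchanges [x] with its folded position. *)
have folded (x : X) : exists2 r : X -> X, pres r & (r (p (u x)) = x /\ r x = p (u x)).
  have [t /andP[t0 t1] <-] := p_surj x.
  have t01 : I01 t by rewrite /I01/= in_itv/= t0 ltW.
  have t01' : I01 (1 - t) by rewrite /I01/= in_itv/= subr_ge0 (ltW t1) gerBl.
  rewrite uE//; have [tt|tt] := leP t (1 - t); first by exists id.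
  exists rho; first by split=> // j z; rewrite /C/= w_rho.
  by rewrite !rhoE// subKr.
(* A homeomorphism supported on the image of (a, b) preserves all cells if that image stays inside
   one open edge up to reflection. *)
have move_in (a b s t : R) (i : nat) : 0 <= a -> b <= 1 -> a < s < b -> a < t < b ->
    (forall z, a < z < b -> i%:R < w (p z) < i.+1%:R) ->
    exists2 f, pres f & f (p s) = p t.
  move=> a0 b1 asb atb wJ.
  have [h [ch hlt hs hout]] := exists_moving_map asb atb.
  have h0 : h 0 = 0 by apply: hout; rewrite negb_and -leNgt a0.
  have h1 : h 1 = 1 by apply: hout; rewrite negb_and -!leNgt b1 orbT.
  have [F hF FE] := curve_increasing_homeo ch hlt h0 h1.
  have s01 : I01 s.
    by move: asb => /andP[as_ sb]; rewrite /I01/= in_itv/=; apply/andP; split; lra.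
  exists F; last by rewrite FE// hs.
  split=> // j z; have [y /andP[y0 y1] <-] := p_surj z.
  rewrite FE; last by rewrite /I01/= in_itv/= y0 ltW.
  have [yJ|yJ] := boolP (a < y < b); last by rewrite (hout _ yJ).
  have hyJ : a < h y < b.
    have ha : h a = a by apply: hout; rewrite ltxx.
    have hb : h b = b by apply: hout; rewrite ltxx andbF.
    by move: (yJ) => /andP[/hlt + /hlt]; rewrite ha hb => -> ->.
  by split; apply: cell_chain_open; apply: wJ; eassumption.
have move_folded x y : (forall j, (j <= k)%N -> C j x <-> C j y) ->
    exists2 f, pres f & f (p (u x)) = p (u y).
  move=> Cxy; have [uxy|uxy] := eqVneq (u x) (u y).
    by exists id => //; rewrite uxy.
  have wxy : w x <> w y by move=> /(mulfI (lt0r_neq0 kR0))/eqP; rewrite (negbTE uxy).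
  have [i [/andP[iwx wxi] /andP[iwy wyi]]] :
      exists i : nat, i%:R < w x < i.+1%:R /\ i%:R < w y < i.+1%:R.
    have [le_w|/ltW le_w] := leP (w x) (w y); first exact: cell_chain_sep Cxy.
    have [||i []] := cell_chain_sep le_w (wk _) (w0 _).
    - by move=> E; apply: wxy.
    - by move=> j jk; rewrite -[_ <-> _]/(C j y <-> C j x) Cxy.
    - by move=> ? ?; exists i.
  have u_gt z : i%:R < w z -> i%:R / k%:R < u z by rewrite ltr_pdivrMr// mulrC.
  have u_lt z : w z < i.+1%:R -> u z < i.+1%:R / k%:R by rewrite ltr_pdivlMr// mulrC.
  have /andP[ux0 ux2] := u12 x; have /andP[uy0 uy2] := u12 y.
  have a0 : 0 <= i%:R / k%:R :> R by rewrite divr_ge0.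
  have aux := u_gt _ iwx; have auy := u_gt _ iwy.
  have uxb := u_lt _ wxi; have uyb := u_lt _ wyi.
  set a := i%:R / k%:R in a0 aux auy; set b := i.+1%:R / k%:R in uxb uyb.
  have w_bounds z : a < u z < b -> i%:R < w z < i.+1%:R.
    by rewrite ltr_pdivrMr// ltr_pdivlMr// mulrC.
  have [b2|b2] := leP b 2^-1.
    apply: (@move_in a b _ _ i) => //; rewrite ?aux ?auy//; first by lra.
    move=> z /andP[az zb]; apply: w_bounds.
    rewrite uE /I01/= ?in_itv/=; last by apply/andP; split; lra.
    by rewrite min_l ?az//; lra.
  (* Here the edge contains the parameter 1/2 fixed by the reflection, so the slide takes place in
     the symmetric interval (a, 1 - a), whose depths lie between [a] and 1/2. *)
  apply: (@move_in a (1 - a) _ _ i); rewrite ?aux ?auy//=; try lra.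
  move=> z /andP[az zb]; apply: w_bounds.
  rewrite uE /I01/= ?in_itv/=; last by apply/andP; split; lra.
  rewrite lt_min gt_min az ltrBrDl -ltrBrDr zb /=.
  by apply/orP; have [z2|z2] := leP z 2^-1; [left|right]; lra.
apply: (@P_h_transitive_chain _ _ C k).
- move=> j jk.
  (* Each level is a finite union of preimages of closed sets under [w]. *)
  rewrite (_ : C j = (if j == k then setT else set0) `|`
      (w @^-1` [set v | v <= j./2%:R] `|`
       (if odd j then w @^-1` [set v | v = j./2.+1%:R] else set0))).
    apply: closedU; first by case: ifP => _; [exact: closedT|exact: closed0].
    apply: closedU; first by apply: preimage_closed => //; exact: closed_le.
    case: ifP => _; last exact: closed0.
    by apply: preimage_closed => //; exact: closed_eq.
  apply/seteqP; split=> x.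
    case=> [->|[H|[oj H]]]; first by left; rewrite eqxx.
      by right; left.
    by right; right; rewrite oj.
  case; first by case: eqP => // jk' _; left.
  case=> [H|]; first by right; left.
  by case: ifP => // oj H; right; right.
- move=> j jk; split.
    move=> x [jE|[H|[oj H]]]; first by move: jk; rewrite jE ltnn.
      right; left; apply: (le_trans H); rewrite ler_nat; exact: half_leq.
    by right; left; rewrite H /= uphalf_half oj.
  (* A new point at level [j + 1]: the next vertex when [j] is even, the midpoint of an edge when
     [j] is odd. At an even [j] with [j + 1 = k] the next vertex would exceed [k / 2], and the fixed
     point of the middle edge is taken. *)
  pose d : R := if odd j || (j.+1 == k) then 2^-1 else 1.
  have d0 : 0 < d <= 1 by rewrite /d; case: ifP => _; lra.
  have [x wx] : exists x, w x = j./2%:R + d.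
    apply: w_surj; rewrite addr_ge0//=; last by have /andP[/ltW] := d0.
    rewrite ler_pdivlMr// mulrDl -natrM /d; case: ifP => jk1.
      by rewrite mulVf// natr1 ler_nat; lia.
    by rewrite mul1r -natrD ler_nat; lia.
  move=> /(_ x) H.
  have : cell_chain k (w x) j.
    apply: H; rewrite /C/= wx /d; have [oj|oj] /= := boolP (odd j).
      by right; left; rewrite /= uphalf_half oj add1n -(natr1 j./2); lra.
    case: ifP => [/eqP jk1|_]; first by left.
    by right; right; split=> //=; rewrite uphalf_half (negbTE oj) add0n natr1.
  rewrite wx; case=> [jE|[|[oj]]]; first by move: jk; rewrite jE ltnn.
    by lra.
  by rewrite /d oj /= -(natr1 j./2); lra.
- by apply/seteqP; split=> // x _; left.
- by exists (p 0); right; left; rewrite /w uE ?subr0 ?min_l ?mulr0//= /I01/= in_itv/= lexx ler01.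
- move=> x y /move_folded[f fpres fxy].
  have [r rpres [_ rx]] := folded x; have [r' rpres' [r'y _]] := folded y.
  have [hF FC] := presM _ _ (presM _ _ rpres' fpres) rpres.
  exists (r' \o f \o r); split=> //.
  by rewrite /= rx fxy r'y.
Qed.

End ClosedCurve.

(** * Rotations and heights on the circle *)

Section Circle.
Variable R : realType.

(** Multiplication by the complex number [c + d i]. *)
Definition rotate (c d : R) (z : R * R) : R * R :=
  (c * z.1 - d * z.2, d * z.1 + c * z.2).

Lemma continuous_rotate c d : continuous (rotate c d).
Proof.
move=> z; apply: (@cvg_pair _ _ _ _ (nbhs _) (nbhs _)).
  by apply: cvgB; apply: cvgMl_tmp; [exact: cvg_fst|exact: cvg_snd].
by apply: cvgD; apply: cvgMl_tmp; [exact: cvg_fst|exact: cvg_snd].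
Qed.

Lemma rotate_circle c d z : circle (c, d) -> circle z -> circle (rotate c d z).
Proof.
rewrite /circle /= => cd z1.
transitivity ((c ^+ 2 + d ^+ 2) * (z.1 ^+ 2 + z.2 ^+ 2)); first by ring.
by rewrite cd z1 mulr1.
Qed.

Lemma rotateK c d : circle (c, d) -> cancel (rotate c d) (rotate c (- d)).
Proof.
rewrite /circle /= => cd [a b]; rewrite /rotate /=; congr (_, _).
  transitivity ((c ^+ 2 + d ^+ 2) * a); [by ring|by rewrite cd mul1r].
transitivity ((c ^+ 2 + d ^+ 2) * b); [by ring|by rewrite cd mul1r].
Qed.

(** The multiplier is [z'] times the conjugate of [z]. *)
Lemma circle_transitive z z' : circle z -> circle z' ->
  exists c d, circle (c, d) /\ rotate c d z = z' :> R * R.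
Proof.
case: z z' => [a b] [a' b']; rewrite /circle /= => ab ab'.
exists (a' * a + b' * b), (b' * a - a' * b); split.
  transitivity ((a ^+ 2 + b ^+ 2) * (a' ^+ 2 + b' ^+ 2)); first by ring.
  by rewrite ab ab' mulr1.
rewrite /rotate /=; congr (_, _).
  transitivity ((a ^+ 2 + b ^+ 2) * a'); [by ring|by rewrite ab mul1r].
transitivity ((a ^+ 2 + b ^+ 2) * b'); [by ring|by rewrite ab mul1r].
Qed.

Lemma P_h_circle (X : topologicalType) : hausdorff_space X ->
  homeomorphic_to_circle R X ->
  P_h R X = range (fun k : nat => ((k%:R : R)%:E)) `|` [set +oo%E].
Proof.
move=> hX [f [g [cf [fC [cg [fK gK]]]]]].
pose p := g \o @angle R.
have cg_comp (T : topologicalType) (h : T -> R * R) : continuous h ->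
    (forall t, circle (h t)) -> continuous (g \o h).
  move=> ch hC; apply: within_setT_continuous.
  apply: continuous_within_comp cg _; first exact: continuous_subspaceT.
  by move=> _ [t _ <-]; exact: hC.
have cp : continuous p by apply: cg_comp; [exact: continuous_angle|exact: angle_circle].
have p_inj s t : 0 <= s < 1 -> 0 <= t < 1 -> p s = p t -> s = t.
  move=> s01 t01 /(congr1 f); rewrite /p /= !gK; try exact: angle_circle.
  exact: angle_inj.
have p_surj x : exists2 t, 0 <= t < 1 & p t = x.
  by have [t t01 tE] := angle_surj (fC x); exists t; rewrite // /p /= tE fK.
have p01 : p 1 = p 0 by rewrite /p /= -[in LHS](add0r 1) angleD1.
have X0 : [set: X] !=set0 by exists (p 0).
have Ph0 : P_h R X (0%:R%:E).
  (* A chain with one term: all points must lie in one orbit, which rotations ensure. *)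
  apply: (@P_h_transitive_chain _ _ (fun=> setT) 0) => //.
  move=> x y _; have [c [d [cd rE]]] := circle_transitive (fC x) (fC y).
  have cd' : circle (c, - d) by rewrite /circle /= sqrrN.
  exists (g \o (rotate c d \o f)); split=> //; last by rewrite /= rE fK.
  exists (g \o (rotate c (- d) \o f)); split.
    apply: cg_comp => [t|t]; last exact: rotate_circle.
    by apply: continuous_comp; [exact: cf|exact: continuous_rotate].
  split.
    apply: cg_comp => [t|t]; last exact: rotate_circle.
    by apply: continuous_comp; [exact: cf|exact: continuous_rotate].
  split=> z /=; rewrite gK; try exact: rotate_circle.
    by rewrite rotateK.
  by rewrite -[d in rotate c d]opprK rotateK.
apply/seteqP; split=> [_ [G _ <-]|_ [[k _ <-]|->]]; first exact: height_cases.
  case: k => [|k]; first exact: Ph0.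
  exact: P_h_curve p01 _ _.
apply: (@P_h_infinite _ _ (fun i => p (i.+2%:R)^-1)) => // i j.
have inv01 (n : nat) : 0 <= (n.+2%:R : R)^-1 < 1.
  by rewrite invr_ge0 ler0n invf_lt1 ?ltr0n// ltr1n.
by move=> /(p_inj _ _ (inv01 i) (inv01 j)) /invr_inj /eqP; rewrite eqr_nat => /eqP [].
Qed.

End Circle.

(** * Charts and degrees *)

Section Charts.
Variables (R : realType) (X : topologicalType).

(** A homeomorphism of [U] with the open interval (0, 1), encoded by two total functions constrained
    only on [U] and on the interval. *)
Definition chart (U : set X) (phi : R -> X) (psi : X -> R) : Prop :=
  [/\ open U,
      forall y, U y -> [/\ {for y, continuous psi}, 0 < psi y < 1 & phi (psi y) = y] &
      forall t, 0 < t < 1 -> [/\ {for t, continuous phi}, U (phi t) & psi (phi t) = t]].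

Definition has_chart (x : X) : Prop :=
  exists U phi psi, chart U phi psi /\ U x.

Lemma homeo_has_chart (f : X -> X) (x : X) : is_homeo f ->
  has_chart (f x) -> has_chart x.
Proof.
move=> [g [cf [cg [fK gK]]]] [U [phi [psi [[oU psiP phiP] Ufx]]]].
exists (f @^-1` U), (g \o phi), (psi \o f); split=> //; split.
- by apply: open_comp => // y _; exact: cf.
- move=> y /= /psiP[cpsi psi01 psiK]; split=> //; last by rewrite psiK fK.
  by apply: continuous_comp; [exact: cf|exact: cpsi].
- move=> t /phiP[cphi Uphi phiK]; split=> /=; rewrite ?gK//.
  by apply: continuous_comp; [exact: cphi|exact: cg].
Qed.

Lemma closed_no_chart : closed [set x | ~ has_chart x].
Proof.
rewrite [X in closed X](_ : _ = ~` [set x | has_chart x])//.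
apply: open_closedC; rewrite openE => x [U [phi [psi [hU Ux]]]].
have [oU _ _] := hU; apply: filterS (open_nbhs_nbhs (conj oU Ux)) => y Uy.
by exists U, phi, psi.
Qed.

End Charts.

(** * Directed edges and degrees of vertices *)

Section Darts.
Variables (R : realType) (X : topologicalType) (n : nat) (e : 'I_n -> R -> X).
Hypotheses (hX : hausdorff_space X) (he : graph_edges e).

Notation dart := ('I_n * bool)%type.
Implicit Types (d : dart) (i j : 'I_n).

(* A dart is an edge with a direction, [true] meaning backwards. *)
Definition dart_curve d (t : R) : X := e d.1 (if d.2 then 1 - t else t).

Definition origin d : X := dart_curve d 0.

Definition flip d : dart := (d.1, ~~ d.2).

Lemma flipK : involutive flip.
Proof. by case=> i b; rewrite /flip /= negbK. Qed.

Lemma dart_curve_flip d t : dart_curve (flip d) t = dart_curve d (1 - t).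
Proof. by rewrite /dart_curve /=; case: d.2 => //=; rewrite subKr. Qed.

Lemma origin_flip d : origin (flip d) = dart_curve d 1.
Proof. by rewrite /origin dart_curve_flip subr0. Qed.

Lemma unit_intervalE (t : R) : unit_interval t <-> 0 <= t <= 1.
Proof. by rewrite /unit_interval/= in_itv. Qed.

Lemma unit_intervalC (t : R) : unit_interval t -> unit_interval (1 - t).
Proof. by rewrite !unit_intervalE => /andP[? ?]; apply/andP; split; lra. Qed.

Lemma unit_interval0 : unit_interval (0 : R).
Proof. by rewrite unit_intervalE lexx ler01. Qed.

Lemma unit_interval1 : unit_interval (1 : R).
Proof. by rewrite unit_intervalE lexx ler01. Qed.

Lemma dart_curve_arc d t : unit_interval t -> arc_of (e d.1) (dart_curve d t).
Proof.
move=> t01; rewrite /dart_curve; case: d.2; last by exists t.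
by exists (1 - t) => //; exact: unit_intervalC.
Qed.

Lemma continuous_1B : continuous (fun t : R => 1 - t).
Proof. by move=> t; apply: cvgB; [exact: cvg_cst|exact: cvg_id]. Qed.

Lemma continuous_edge i : {within @unit_interval R, continuous (e i)}.
Proof. by have [_ [/(_ i)[g []]]] := he. Qed.

Lemma continuous_dart_curve d : {within @unit_interval R, continuous (dart_curve d)}.
Proof.
rewrite /dart_curve; case: d.2 => /=; last exact: continuous_edge.
apply: (continuous_within_comp (continuous_subspaceT continuous_1B)
  (@continuous_edge d.1)).
by move=> _ [t t01 <-]; exact: unit_intervalC.
Qed.

Lemma closed_arc i : closed (arc_of (e i)).
Proof.
apply: compact_closed => //; apply: continuous_compact (@continuous_edge i) _.
exact: segment_compact.
Qed.

Lemma arc_cover x : exists i, arc_of (e i) x.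
Proof.
by have [_ [_ [/seteqP[_ /(_ x I)[i _]]]]] := he; exists i.
Qed.

Lemma arc_meet i j x : i != j -> arc_of (e i) x -> arc_of (e j) x ->
  endpoints (e i) x /\ endpoints (e j) x.
Proof. by have [_ [_ [_ /[apply]]]] := he => h ? ?; apply: h. Qed.

Lemma dart_coord d : exists c : X -> R,
  [/\ {within arc_of (e d.1), continuous c},
      forall t, unit_interval t -> c (dart_curve d t) = t &
      forall x, arc_of (e d.1) x -> unit_interval (c x) /\ dart_curve d (c x) = x].
Proof.
have [_ [/(_ d.1)[g [_ [cg gK]]] _]] := he; rewrite /dart_curve; case: d.2.
  exists (fun x => 1 - g x); split.
  - exact: (continuous_within_comp (B := setT) cg (continuous_subspaceT continuous_1B)).
  - by move=> t /unit_intervalC t01; rewrite gK// subKr.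
  - by move=> _ [t t01 <-]; rewrite gK// subKr; split=> //; exact: unit_intervalC.
by exists g; split=> // _ [t t01 <-]; rewrite gK.
Qed.

Lemma dart_curve_inj d s t : unit_interval s -> unit_interval t ->
  dart_curve d s = dart_curve d t -> s = t.
Proof.
by move=> s01 t01 st; have [c [_ cK _]] := dart_coord d; rewrite -(cK s)// st cK.
Qed.

Lemma endpoints_dart d x : endpoints (e d.1) x <-> x = origin d \/ x = origin (flip d).
Proof.
rewrite /origin /endpoints/= /dart_curve /=; case: d.2; rewrite /= subr0.
  by split=> -[]; tauto.
by [].
Qed.

Lemma endpointsP i x : endpoints (e i) x -> exists2 d, d.1 = i & origin d = x.
Proof.
move=> /(endpoints_dart (i, false))[] ->; first by exists (i, false).
by exists (flip (i, false)).
Qed.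

Lemma origin_endpoints d : endpoints (e d.1) (origin d).
Proof. by apply/endpoints_dart; left. Qed.

Lemma origin_arc d : arc_of (e d.1) (origin d).
Proof. exact: dart_curve_arc unit_interval0. Qed.

Lemma origin_flip_neq d : origin d <> origin (flip d).
Proof.
rewrite origin_flip => /dart_curve_inj /eqP.
by rewrite eq_sym oner_eq0 => /(_ unit_interval0 unit_interval1).
Qed.

Lemma same_edge_darts d d' : d.1 = d'.1 -> d' = d \/ d' = flip d.
Proof.
case: d d' => [i b] [j b'] /= ->; rewrite /flip /=.
by case: b b' => [] [] /=; [left|right|right|left].
Qed.

Lemma origin_inj_edge d d' : d.1 = d'.1 -> origin d = origin d' -> d = d'.
Proof. by move=> /same_edge_darts[->|-> /origin_flip_neq]. Qed.

Lemma inner_not_endpoint d t : 0 < t < 1 -> ~ endpoints (e d.1) (dart_curve d t).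
Proof.
move=> /andP[t0 t1] /endpoints_dart[|]; rewrite ?origin_flip => /dart_curve_inj tE.
  have : t = 0 by apply: tE; rewrite unit_intervalE ?lexx ?ler01 ?(ltW t0) ?ltW.
  by move=> tE0; rewrite tE0 ltxx in t0.
have : t = 1 by apply: tE; rewrite unit_intervalE ?lexx ?ler01 ?(ltW t0) ?ltW.
by move=> tE1; rewrite tE1 ltxx in t1.
Qed.

Lemma closed_other_arcs i : closed (\bigcup_(j in [set j | j != i]) arc_of (e j)).
Proof.
by apply: closed_bigcup => [|j _]; [exact: finite_finset|exact: closed_arc].
Qed.

Lemma degree_card v : degree e v = #|[set i | `[< endpoints (e i) v >]]%SET|.
Proof.
by rewrite /degree -sum1_card [RHS]big_mkcond /=; apply: eq_bigr => i _; rewrite inE; case: asboolP.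
Qed.

(** Removing the finitely many other closed arcs and the two end points leaves an open set, on which
    the edge and its inverse form a chart. *)
Lemma inner_has_chart i t : 0 < t < 1 -> has_chart R (e i t).
Proof.
move=> t01; pose d : dart := (i, false).
have [c [cc cK Kc]] := dart_coord d.
pose U := ~` (\bigcup_(j in [set j | j != i]) arc_of (e j) `|` endpoints (e i)).
have oU : open U.
  apply: closed_openC; apply: closedU; first exact: closed_other_arcs.
  apply: (accessible_finite_set_closed.1 (hausdorff_accessible hX)).
  exact: finite_set2.
have in01 (q : R) : 0 < q < 1 -> unit_interval q.
  by move=> /andP[q0 q1]; apply/unit_intervalE; rewrite !ltW.
have Uin (q : R) : 0 < q < 1 -> U (e i q).
  move=> q01 [[j /= ji qj]|]; last exact: (@inner_not_endpoint d).
  have [|_] := arc_meet ji qj; first by exists q => //; exact: in01.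
  exact: (@inner_not_endpoint d).
have UP y : U y -> arc_of (e i) y.
  move=> Uy; have [j jy] := arc_cover y; have [<-//|ji] := eqVneq j i.
  by exfalso; apply: Uy; left; exists j.
exists U, (e i), c; split; last exact: Uin.
split=> // [y Uy|q q01].
- have [/unit_intervalE c01 cE] := Kc y (UP y Uy); split=> //.
    have : {within U, continuous c} by apply: continuous_subspaceW cc.
    by rewrite continuous_open_subspace// => /(_ y); apply; rewrite inE.
  move: c01; rewrite !le_eqVlt => /andP[].
  case: eqP => [c0|_ /= c0]; first by exfalso; apply: Uy; right; rewrite -cE -c0; left.
  case: eqP => [c1|_ /= c1]; first by exfalso; apply: Uy; right; rewrite -cE c1; right.
  by rewrite c0.
- split; [|exact: Uin|by apply: cK; exact: in01].
  have : {within `]0, 1[%classic, continuous (e i)}.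
    apply: continuous_subspaceW (@continuous_edge i) => z /=.
    by rewrite in_itv/= => /in01.
  rewrite continuous_open_subspace => [/(_ q)|]; last exact: itv_open.
  by apply; rewrite inE /= in_itv.
Qed.

(* By the intermediate value theorem, in a chart the dart covers one of the two
   sides of its origin. *)
Lemma dart_side U phi psi d : chart U phi psi -> U (origin d) ->
  exists b : bool, exists2 del : R, 0 < del &
  forall r, 0 < r < del -> exists2 q, 0 < q < 1 &
    phi (psi (origin d) + (-1) ^+ b * r) = dart_curve d q.
Proof.
move=> [oU psiP phiP] Uv.
have [eps /andP[eps0 eps1] epsU] : exists2 eps : R, 0 < eps < 1 &
    forall t, 0 <= t <= eps -> U (dart_curve d t).
  have /open_subspaceP[V oV VE] := (continuousP _).1 (@continuous_dart_curve d) _ oU.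
  have V0 : V 0.
    have [] : (V `&` @unit_interval R) 0 by rewrite VE; split=> //; exact: unit_interval0.
    by [].
  have /nbhs_ballP[r /= r0 rV] := open_nbhs_nbhs (conj oV V0).
  exists (Num.min (r / 2) 2^-1); first by rewrite lt_min gt_min; lra.
  move=> t; rewrite le_min => /and3P[t0 tr t2].
  have : (V `&` @unit_interval R) t.
    split; last by apply/unit_intervalE; lra.
    by apply: rV; rewrite /ball/= sub0r normrN ger0_norm//; lra.
  by rewrite VE => -[].
have in01 t : 0 <= t <= eps -> unit_interval t.
  by move=> /andP[t0 te]; apply/unit_intervalE; rewrite t0 ltW// (le_lt_trans te).
pose f := psi \o dart_curve d.
have cf : {within `[0, eps]%classic, continuous f}.
  apply: (@continuous_within_comp _ _ _ _ U).
  - apply: continuous_subspaceW (@continuous_dart_curve d) => t /=.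
    by rewrite in_itv/= => /in01.
  - by rewrite continuous_open_subspace// => y /[!inE] /psiP[].
  - by move=> _ [t tb <-]; apply: epsU; move: tb; rewrite /= in_itv.
have f0 : f 0 = psi (origin d) by [].
have f_phi t : 0 <= t <= eps -> phi (f t) = dart_curve d t.
  by move=> /epsU /psiP[].
(* The dart leaves its origin for good, so its chart coordinate changes; the direction of change is
   the side. *)
have fneq : f eps != f 0.
  apply/eqP => /(congr1 phi); rewrite !f_phi ?lexx ?(ltW eps0)//.
  have e01 : unit_interval eps by apply: in01; rewrite lexx ltW.
  by move/(dart_curve_inj e01 unit_interval0) => e0; move: eps0; rewrite e0 ltxx.
(* Every value between [f 0] and [f eps] is attained; excluding [f 0] keeps the parameter positive,
   hence interior to the edge. *)
have key s : Num.min (f 0) (f eps) <= s <= Num.max (f 0) (f eps) ->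
    s != f 0 -> exists2 q, 0 < q < 1 & phi s = dart_curve d q.
  move=> sb sn0; have [q] := IVT (ltW eps0) cf sb.
  rewrite in_itv/= => q01 fq; exists q; last by rewrite -fq f_phi.
  move: q01 => /andP[q0 qe]; rewrite (le_lt_trans qe)// andbT lt_neqAle q0 andbT.
  by apply: contra_neq sn0 => q00; rewrite -fq -q00.
have [ltf|gtf|eqf] := ltgtP (f 0) (f eps); last by rewrite eqf eqxx in fneq.
- exists false, (f eps - f 0); rewrite ?subr_gt0// => r /andP[r0 rd].
  rewrite expr0 mul1r -f0; apply: key; last by rewrite gt_eqF// ltrDl.
  by rewrite min_l ?max_r ?(ltW ltf)//; lra.
- exists true, (f 0 - f eps); rewrite ?subr_gt0// => r /andP[r0 rd].
  rewrite expr1 mulN1r -f0; apply: key; last by rewrite lt_eqF// gtrBl.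
  by rewrite min_r ?max_l ?(ltW gtf)//; lra.
Qed.

(** Two edges on the same side of [v] would share points close to [v] that are interior to an edge.
    Hence sending an edge to its side is injective into a set of two elements. *)
Lemma chart_degree_le2 v : has_chart R v -> (degree e v <= 2)%N.
Proof.
move=> [U [phi [psi [hU Uv]]]]; rewrite degree_card.
set A := finset _.
have dartP i : exists d, i \in A -> d.1 = i /\ origin d = v.
  have [iA|_] := boolP (i \in A); last by exists (i, false).
  move: iA; rewrite inE => /asboolP /endpointsP[d ? ?]; by exists d.
have {}[D DP] := choice dartP.
have arcD i (q : R) : i \in A -> 0 < q < 1 -> arc_of (e i) (dart_curve (D i) q).
  move=> /DP[Di _] /andP[q0 q1]; have := @dart_curve_arc (D i) q.
  by rewrite Di; apply; apply/unit_intervalE; rewrite !ltW.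
have sideP i : exists b : bool, i \in A -> exists2 del : R, 0 < del &
    forall r, 0 < r < del -> exists2 q, 0 < q < 1 &
    phi (psi v + (-1) ^+ b * r) = dart_curve (D i) q.
  have [/DP[_ vE]|_] := boolP (i \in A); last by exists true.
  have [|b H] := @dart_side U phi psi (D i) hU; first by rewrite vE.
  by exists b; rewrite -vE.
have [S SP] := choice sideP.
have S_inj : {in A &, injective S}.
  move=> i j iA jA Sij; apply/eqP/negP => /negP ij.
  have [del del0 H] := SP i iA; have [del' del'0 H'] := SP j jA.
  have [q q01 qE] : exists2 q, 0 < q < 1 &
      phi (psi v + (-1) ^+ S i * (Num.min del del' / 2)) = dart_curve (D i) q.
    apply: H; have [|] := leP del del' => ?; apply/andP; split; lra.
  have [q' q'01 q'E] : exists2 q, 0 < q < 1 &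
      phi (psi v + (-1) ^+ S j * (Num.min del del' / 2)) = dart_curve (D j) q.
    apply: H'; have [|] := leP del del' => ?; apply/andP; split; lra.
  have [Di _] := DP i iA; have [Dj _] := DP j jA.
  have [|||endi _] := @arc_meet i j (dart_curve (D i) q) => //.
  - exact: arcD.
  - by rewrite -qE Sij q'E; exact: arcD.
  - by apply: (inner_not_endpoint (d := D i) q01); rewrite Di.
by rewrite -(card_in_imset S_inj) -card_bool max_card.
Qed.

(** If only one edge ended at [v], its coordinate would be an injective continuous function on a
    chart interval around [v], with its minimum at an interior point; this contradicts the
    intermediate value theorem. *)
Lemma chart_degree_ge2 v : is_vertex e v -> has_chart R v -> (2 <= degree e v)%N.
Proof.
move=> [i /[dup] ei /endpointsP[d di dv]] [U [phi [psi [[oU psiP phiP] Uv]]]].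
rewrite degree_card leqNgt; apply/negP => A1.
have only_i j : endpoints (e j) v -> j = i.
  move=> ej; apply/eqP/negP => /negP ji.
  move: A1; rewrite ltnNge => /negP; apply; apply/card_gt1P.
  by exists j, i; rewrite !inE; split=> //; apply/asboolP.
have [c [cc cK Kc]] := dart_coord d.
have [_ /andP[t0 t1] phiv] := psiP v Uv; set t := psi v in t0 t1 phiv.
set K := \bigcup_(j in [set j | j != i]) arc_of (e j).
have oK : open (~` K) by apply: closed_openC; exact: closed_other_arcs.
have nKv : (~` K) v.
  move=> [j /= ji vj]; have iv : arc_of (e i) v by rewrite -dv -di; exact: origin_arc.
  have [/only_i jE _] := arc_meet ji vj iv.
  by rewrite jE eqxx in ji.
have nb : nbhs t (fun s => (~` K) (phi s)).
  have t01 : 0 < t < 1 by rewrite t0.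
  have [cphi _ _] := phiP t t01.
  by apply: cphi; rewrite phiv; exact: open_nbhs_nbhs (conj oK nKv).
(* Close to [v] the chart avoids all other arcs, so it runs inside the single edge. *)
have [del /andP[del0 delt] delK] : exists2 del : R, 0 < del < Num.min t (1 - t) &
    forall s, t - del <= s <= t + del -> ~ K (phi s).
  have /nbhs_ballP[r /= r0 rV] := nb.
  have m0 : 0 < Num.min t (1 - t) by rewrite lt_min t0 subr_gt0.
  exists (Num.min (r / 2) (Num.min t (1 - t) / 2)).
    by rewrite lt_min gt_min; apply/andP; split; [apply/andP; split; lra|apply/orP; right; lra].
  move=> s sb; apply: rV; rewrite /ball/= ltr_distlC.
  have : Num.min (r / 2) (Num.min t (1 - t) / 2) <= r / 2 by rewrite ge_min lexx.
  by move: sb => /andP[? ?] ?; apply/andP; split; lra.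
move: delt; rewrite lt_min => /andP[delt delt1].
have in01 s : t - del <= s <= t + del -> 0 < s < 1.
  by move=> /andP[? ?]; apply/andP; split; lra.
have arcP s : t - del <= s <= t + del -> arc_of (e d.1) (phi s).
  move=> sb; rewrite di; have [j jE] := arc_cover (phi s).
  have [<-//|ji] := eqVneq j i.
  by exfalso; apply: (delK s sb); exists j.
pose f := c \o phi.
have cf : {within `[t - del, t + del]%classic, continuous f}.
  apply: (@continuous_within_comp _ _ _ _ (arc_of (e d.1))) => //.
    apply: continuous_in_subspaceT => s; rewrite inE /= in_itv/= => /in01 s01.
    by have [] := phiP s s01.
  by move=> _ [s sb <-]; apply: arcP; move: sb; rewrite /= in_itv.
have ft : f t = 0 by rewrite /f /= phiv -dv /origin cK//; exact: unit_interval0.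
have f_inj s s' : t - del <= s <= t + del -> t - del <= s' <= t + del ->
    f s = f s' -> s = s'.
  move=> sb sb' /(congr1 (dart_curve d)); rewrite /f /=.
  have [_ ->] := Kc _ (arcP s sb); have [_ ->] := Kc _ (arcP s' sb').
  move/(congr1 psi); have [_ _ ->] := phiP s (in01 _ sb).
  by have [_ _ ->] := phiP s' (in01 _ sb').
have f_ge0 s : t - del <= s <= t + del -> 0 <= f s.
  by move=> /arcP /Kc[/unit_intervalE/andP[]].
have f_gt0 s : t - del <= s <= t + del -> s != t -> 0 < f s.
  move=> sb st; rewrite lt_neqAle f_ge0// andbT eq_sym -ft.
  by apply: contra_neq st => /f_inj; apply=> //; apply/andP; split; lra.
have L0 : 0 < f (t - del).
  by apply: f_gt0; [apply/andP; split; lra|apply/eqP; lra].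
have R0 : 0 < f (t + del).
  by apply: f_gt0; [apply/andP; split; lra|apply/eqP; lra].
(* A positive level attained on both sides of [t], against injectivity. *)
pose m := Num.min (f (t - del)) (f (t + del)).
have m0 : 0 < m by rewrite lt_min L0.
have mL : m <= f (t - del) by rewrite ge_min lexx.
have mR : m <= f (t + del) by rewrite ge_min lexx orbT.
have [|||s1 s1b f1] := @IVT R f (t - del) t m.
- lra.
- by apply: continuous_subspaceW cf => s /=; rewrite !in_itv/= => /andP[? ?]; apply/andP; split; lra.
- by rewrite ft min_r ?max_l ?(ltW L0)// mL ltW.
have [|||s2 s2b f2] := @IVT R f t (t + del) m.
- lra.
- by apply: continuous_subspaceW cf => s /=; rewrite !in_itv/= => /andP[? ?]; apply/andP; split; lra.
- by rewrite ft min_l ?max_r ?(ltW R0)// mR ltW.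
move: s1b s2b; rewrite !in_itv/= => /andP[? ?] /andP[? ?].
have s12 : s1 = s2.
  by apply: f_inj; rewrite ?f1 ?f2//; apply/andP; split; lra.
have st : s1 = t by lra.
by move: m0; rewrite -f1 st ft ltxx.
Qed.

(** A vertex without a chart would make the set of such points nonempty. This set is closed,
    invariant and misses midpoints of edges, so it would start a chain of length 1. *)
Lemma minimal_degree2 : P_h R X (0 : R)%:E -> forall v, is_vertex e v -> degree e v = 2%N.
Proof.
move=> [G [Ghomeo [_ [_ Ginv]]] G0] v vv; apply/eqP; rewrite eqn_leq.
have [hv|nhv] := pselect (has_chart R v).
  by rewrite chart_degree_le2// chart_degree_ge2.
exfalso; pose N : set X := [set x | ~ has_chart R x].
have [n0 _] := he; pose i0 := Ordinal n0.
have : inv_chain G 1.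
  exists (fun k : nat => if k == 0%N then N else setT); split.
    move=> k _; case: ifP => _; last by split; [exact: closedT|split; [exists v|]].
    split; first exact: closed_no_chart.
    split; first by exists v.
    by move=> g y /Ghomeo hg Ny /(homeo_has_chart hg).
  split=> // -[|//] _ /=; split=> // /(_ (e i0 2^-1) I); apply.
  by apply: inner_has_chart; lra.
move=> G1; have : (1%:R%:E <= height R G)%E by apply: ereal_sup_ubound; exists 1%N.
by rewrite G0 lee_fin ler10.
Qed.

End Darts.

(** * Graphs with all degrees equal to 2 *)

Section Cycle.
Variables (R : realType) (X : topologicalType) (n : nat) (e : 'I_n -> R -> X).
Hypotheses (hX : hausdorff_space X) (he : graph_edges e).
Hypothesis deg2 : forall v, is_vertex e v -> degree e v = 2%N.

Notation dart := ('I_n * bool)%type.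
Implicit Types (d : dart) (i j : 'I_n) (k l : nat).

(** The dart [turn d] is the other way out of the origin of [d]. Degree 2 supplies exactly one other
    edge there, and since the ends of an edge differ, that edge leaves the vertex by only one
    dart. *)
Lemma exists_turn : exists turn : dart -> dart, forall d,
  [/\ origin e (turn d) = origin e d, (turn d).1 != d.1 &
      forall d', origin e d' = origin e d -> d' = d \/ d' = turn d].
Proof.
suff turnP d : exists d1, [/\ origin e d1 = origin e d, d1.1 != d.1 &
      forall d', origin e d' = origin e d -> d' = d \/ d' = d1].
  by have [turn ?] := choice turnP; exists turn.
have end_d := origin_endpoints e d.
have := deg2 (ex_intro _ d.1 end_d); rewrite degree_card => /eqP/cards2P.
set A := finset _ => -[i [j [ij AE]]].
have AP i' : i' \in A <-> endpoints (e i') (origin e d).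
  by rewrite inE; split=> /asboolP.
have [j1 [jd Ad]] : exists j1, j1 != d.1 /\ A = [set d.1; j1]%SET.
  have : d.1 \in A by apply/AP.
  rewrite AE !inE => /orP[]/eqP->; first by exists j; rewrite eq_sym.
  by exists i; split=> //; rewrite finset.setUC.
have /AP/endpointsP[d1 d1j d1o] : j1 \in A by rewrite Ad !inE eqxx orbT.
exists d1; split; rewrite ?d1j// => d' d'o.
have : d'.1 \in A by apply/AP; rewrite -d'o; exact: origin_endpoints.
rewrite Ad !inE => /orP[]/eqP d'E; [left|right]; apply: (origin_inj_edge he) => //.
  by rewrite d'E d1j.
by rewrite d'o d1o.
Qed.

(** * The walk along the edges *)

Section Traversal.
Variable turn : dart -> dart.
Hypothesis turnP : forall d, [/\ origin e (turn d) = origin e d, (turn d).1 != d.1 &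
      forall d', origin e d' = origin e d -> d' = d \/ d' = turn d].

Let turnK : involutive turn.
Proof.
move=> d; have [od nd _] := turnP d; have [_ _ /(_ d)] := turnP (turn d).
by rewrite od => /(_ erefl)[dE|//]; rewrite -dE eqxx in nd.
Qed.

(** One step of the walk: run along [d] to its end and leave by the other edge there. *)
Let next d := turn (flip d).

Let origin_next d : origin e (next d) = origin e (flip d).
Proof. by have [] := turnP (flip d). Qed.

Let next_inj : injective next.
Proof. exact: inj_comp (inv_inj turnK) (inv_inj (@flipK n)). Qed.

(* The traversal never runs an edge backwards: the two ends of the walk can be
   shortened simultaneously until it has at most one step. *)
Let iter_next_neq_flip k d : iter k next d <> flip d.
Proof.
have [m] := ubnP k; elim: m k d => // m IH [|[|k]] d.
- by move=> _ /(congr1 snd) /=; case: d.2.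
- by move=> _ /= E; have [_ + _] := turnP (flip d); rewrite -/(next d) E eqxx.
rewrite ltnS => km E; apply: (IH k (next d)); first exact: ltnW.
(* Cancelling the involutions moves the last step to the other side: the equation for [d] becomes
   the one for [next d] with two steps fewer. *)
apply: (inv_inj (@flipK n)); rewrite flipK -iterSr.
by apply: (inv_inj turnK); rewrite [RHS]turnK.
Qed.

Hypothesis (d0 : dart).
Let m := order next d0.
Let D k := iter k next d0.

Let m_gt0 : (0 < m)%N. Proof. exact: order_gt0. Qed.

Let Dm : D m = d0. Proof. exact: iter_order. Qed.

Let D_inj k l : (k < m)%N -> (l < m)%N -> D k = D l -> k = l.
Proof. by move=> km lm E; rewrite -(findex_iter km) -/(D k) E findex_iter. Qed.

Let D_mod k : exists2 l, (l < m)%N & D l = D k.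
Proof.
have c := fconnect_iter next k d0.
by exists (findex next d0 (D k)); [exact: findex_max|exact: iter_findex].
Qed.

Let D_pred k : exists l, D k = next (D l).
Proof.
case: k => [|k]; last by exists k.
(* The walk is periodic, so the start is preceded by the last dart of the period. *)
by exists m.-1; rewrite /D -iterS prednK// -/(D m) Dm.
Qed.

Let D_neq_flip k l : D k <> flip (D l).
Proof.
have [lk|/ltnW kl] := leqP l k.
  by rewrite /D -(subnK lk) iterD; exact: iter_next_neq_flip.
move=> E; apply: (@iter_next_neq_flip (l - k) (D k)).
by rewrite [in RHS]E flipK /D -iterD subnK.
Qed.

Let D_edge k l : (D k).1 = (D l).1 -> D k = D l.
Proof. by move/same_edge_darts => [//|/D_neq_flip]. Qed.

Let turn_D k : exists l, turn (D k) = flip (D l).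
Proof. by have [l ->] := D_pred k; exists l; rewrite /next turnK. Qed.

(** The other dart leaving the origin of [D l] is a walked dart reversed, which the walk never
    uses. *)
Let D_origin k l : origin e (D k) = origin e (D l) -> D k = D l.
Proof.
move=> E; have [_ _ /(_ _ E)[//|]] := turnP (D l).
by have [l' ->] := turn_D l => /D_neq_flip.
Qed.

Hypothesis connX : connected [set: X].

(** The walked edges and the remaining ones form two disjoint closed sets covering the space, so
    connectedness leaves nothing unwalked. *)
Let traversal_cover x : exists2 k, (k < m)%N & arc_of (e (D k).1) x.
Proof.
pose S := [set i | exists k, (D k).1 = i].
have cl (T : set 'I_n) : closed (\bigcup_(i in T) arc_of (e i)).
  by apply: closed_bigcup => [|i _]; [exact: finite_finset|exact: closed_arc].
have SC : \bigcup_(i in S) arc_of (e i) = ~` (\bigcup_(i in ~` S) arc_of (e i)).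
  apply/seteqP; split=> [y [i [k ki] yi] [j /= nSj yj]|y nSy].
    have ij : i != j by apply/eqP => ij; apply: nSj; exists k; rewrite ki.
    have [/endpointsP[d di dy] /endpointsP[d' dj d'y]] := arc_meet he ij yi yj.
    (* At a common point the unwalked dart would be the turn of a walked one, up to direction, and
       that turn is again on a walked edge. *)
    have d'E : d' = turn d.
      have [_ _ /(_ d')[||//]] := turnP d; first by rewrite dy d'y.
      by move=> dd'; rewrite -di -dj dd' eqxx in ij.
    apply: nSj; rewrite /S/= -dj d'E.
    have [->|->] : d = D k \/ d = flip (D k) by apply: same_edge_darts; rewrite ki.
      by have [l ->] := turn_D k; exists l.
    by exists k.+1.
  have [i yi] := arc_cover he y; exists i => //.
  by apply: contrapT => nSi; apply: nSy; exists i.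
have : \bigcup_(i in S) arc_of (e i) = [set: X].
  apply: connX.
  - exists (origin e d0), d0.1; first by exists 0%N.
    exact: origin_arc.
  - by exists (\bigcup_(i in S) arc_of (e i)); rewrite ?setTI// SC; exact: closed_openC.
  - by exists (\bigcup_(i in S) arc_of (e i)); rewrite ?setTI.
move=> /seteqP[_ /(_ x I)[_ [k <-] xk]].
by have [l lm lk] := D_mod k; exists l; rewrite ?lk.
Qed.

(** The end of [D k], at parameter 1, is rewritten as the start of the next dart, with its index
    reduced modulo the period. *)
Let traversal_rep x : exists kt : nat * R,
  [/\ (kt.1 < m)%N, 0 <= kt.2 < 1 & dart_curve e (D kt.1) kt.2 = x].
Proof.
have [k km xk] := traversal_cover x.
have [c [_ _ /(_ x xk)[/unit_intervalE/andP[c0]]]] := dart_coord he (D k).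
rewrite le_eqVlt => /predU1P[->|c1] xE; last by exists (k, c x); rewrite c0.
have [l lm lE] := D_mod k.+1; exists (l, 0); split=> //=; first by rewrite lexx ltr01.
by rewrite -xE -origin_flip -origin_next lE.
Qed.

Let mR_gt0 : 0 < m%:R :> R. Proof. by rewrite ltr0n. Qed.

(** The angle does not depend on the edge used to describe the point: a point on two walked edges is
    the end of one and the origin of its successor in the cyclic order. *)
Let traversal_angle k l (t s : R) : (k < m)%N -> (l < m)%N -> unit_interval t -> 0 <= s < 1 ->
  dart_curve e (D k) t = dart_curve e (D l) s ->
  angle ((k%:R + t) / m%:R) = angle ((l%:R + s) / m%:R).
Proof.
move=> km lm t01 /andP[s0 s1] E.
have s01 : unit_interval s by apply/unit_intervalE; rewrite s0 ltW.
have [kl|kl] := eqVneq k l.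
  by move: E; rewrite kl => /(dart_curve_inj he t01 s01) ->.
have Dkl : (D k).1 != (D l).1.
  by apply/eqP => /D_edge /(D_inj km lm) klE; rewrite klE eqxx in kl.
have xk := dart_curve_arc e (D k) t01; have xl := dart_curve_arc e (D l) s01.
rewrite -E in xl.
have [/endpoints_dart xk' /endpoints_dart xl'] := arc_meet he Dkl xk xl.
have s00 : s = 0.
  move: xl'; rewrite E; case=> [|]; rewrite ?origin_flip.
    by move/(dart_curve_inj he s01 (@unit_interval0 R)).
  by move/(dart_curve_inj he s01 (@unit_interval1 R)) => s1E; rewrite s1E ltxx in s1.
have Eo : dart_curve e (D k) t = origin e (D l) by rewrite E s00.
case: xk' => [xk'|]; first by move: kl; rewrite (D_inj km lm (D_origin _)) ?eqxx// -xk'.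
rewrite origin_flip => /(dart_curve_inj he t01 (@unit_interval1 R)) t1.
have DE : D k.+1 = D l by apply: D_origin; rewrite -Eo t1 -origin_flip -origin_next.
rewrite s00 t1 addr0 natr1.
have [k1m|mk1] := ltnP k.+1 m; first by rewrite (D_inj k1m lm DE).
have km1 : k.+1 = m by apply/eqP; rewrite eqn_leq km mk1.
have l0 : l = 0%N by apply: D_inj => //; rewrite -DE km1 Dm.
(* The walk closes up here, where the parameters 1 and 0 give the same angle. *)
by rewrite km1 l0 mul0r divff ?gt_eqF// -[in LHS](add0r 1) angleD1.
Qed.

Hypothesis cX : compact [set: X].

(** Independence of the representative lets continuity be checked on each closed arc. Injectivity
    follows by comparing integer and fractional parts, and compactness gives continuity of the
    inverse. *)
Lemma traversal_homeomorphic_to_circle : homeomorphic_to_circle R X.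
Proof.
have [r rP] := choice traversal_rep.
pose th x : R := ((r x).1%:R + (r x).2) / m%:R.
pose f x := angle (th x).
have fE k t : (k < m)%N -> unit_interval t ->
    f (dart_curve e (D k) t) = angle ((k%:R + t) / m%:R).
  move=> km t01; have [r1 r2 rE] := rP (dart_curve e (D k) t).
  exact/esym/traversal_angle.
have fcirc x : circle (f x) by exact: angle_circle.
have cf : continuous f.
  apply: (finite_pasting (I := 'I_m) (A := fun a : 'I_m => arc_of (e (D a).1))).
  - by move=> a; exact: closed_arc.
  - move=> k; have [c [cc _ cE]] := dart_coord he (D k).
    have ch : continuous (fun t : R => angle ((k%:R + t) / m%:R)).
      move=> t; apply: (@continuous_comp _ _ _ (fun t : R => (k%:R + t) / m%:R)
        (@angle R)); last exact: continuous_angle.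
      apply: cvgMr_tmp; apply: cvgD; [exact: cvg_cst|exact: cvg_id].
    have cch := continuous_within_comp (B := setT) cc (continuous_subspaceT ch).
    apply: (subspace_eq_continuous _ (cch _)) => // x /[!inE] /cE[cx xE].
    by have := fE k (c x) (ltn_ord k) cx; rewrite xE => fxE; rewrite /from_subspace fxE.
  - by move=> x; have [k km xk] := traversal_cover x; exists (Ordinal km).
have th01 x : 0 <= th x < 1.
  have [r1 /andP[r20 r21] _] := rP x; rewrite /th divr_ge0 ?addr_ge0//=.
  rewrite ltr_pdivrMr// mul1r; apply: (@lt_le_trans _ _ ((r x).1.+1%:R)).
    by rewrite -natr1 ltrD2l.
  by rewrite ler_nat.
have f_inj : injective f.
  move=> x y /(angle_inj (th01 x) (th01 y)) /(mulIf (invr_neq0 (lt0r_neq0 mR_gt0))).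
  have [_ /andP[x0 x1] xE] := rP x; have [_ /andP[y0 y1] yE] := rP y.
  suff: (r x).1%:R + (r x).2 = (r y).1%:R + (r y).2 -> r x = r y.
    by move=> rxy /rxy E; rewrite -xE E.
  move: (r x) (r y) x0 x1 y0 y1 {xE yE} => [k t] [l s] /= t0 t1 s0 s1 kl.
  have kl1 : k%:R < l.+1%:R :> R by rewrite -natr1; lra.
  have lk1 : l%:R < k.+1%:R :> R by rewrite -natr1; lra.
  have klE : k = l by apply/eqP; rewrite eqn_leq; move: kl1 lk1; rewrite !ltr_nat !ltnS => -> ->.
  by move: kl; rewrite klE => /addrI ->.
have f_surj p : circle p -> exists x, f x = p.
  move=> /angle_surj[q /andP[q0 q1] <-].
  have qm : 0 <= q * m%:R by rewrite mulr_ge0.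
  (* The integer part of [q * m] selects the edge, the fractional part the point on it. *)
  have [k /andP[kq qk]] : exists k, k%:R <= q * m%:R < k.+1%:R.
    by exists (Num.truncn (q * m%:R)); exact: truncn_itv.
  exists (dart_curve e (D k) (q * m%:R - k%:R)); rewrite fE.
  - by rewrite subrKC mulfK// gt_eqF.
  - by rewrite -(ltr_nat R); apply: (le_lt_trans kq); rewrite gtr_pMl.
  - by apply/unit_intervalE; move: qk; rewrite -natr1 => qk; apply/andP; split; lra.
have /choice[g gP] p : exists x, circle p -> f x = p.
  have [/f_surj[x xp]|np] := pselect (circle p); first by exists x.
  (* An arbitrary value off the circle. *)
  by exists (origin e d0) => /np.
exists f, g; split=> //; split=> //.
have fK x : g (f x) = x by apply: f_inj; rewrite gP.
split; last by [].
have -> : @circle R = f @` [set: X].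
  by apply/seteqP; split=> [p /f_surj[x]|_ [x _ <-]//]; exists x.
apply: continuous_factor => //.
- exact: continuous_subspaceT.
- apply: continuous_subspaceT; have -> : g \o f = idfun by apply/funext.
  by move=> x; exact: cvg_id.
Qed.

End Traversal.
End Cycle.

Theorem theorem5p8 (R : realType) (X : pseudoMetricType R) (n : nat)
  (e : 'I_n -> R -> X) :
  topological_graph e ->
  [<-> homeomorphic_to_circle R X;
       P_h R X = range (fun k : nat => ((k%:R : R)%:E)) `|` [set +oo%E];
       P_h R X ((0 : R)%:E);
       forall v, is_vertex e v -> degree e v = 2%N].
Proof.
move=> [hX [cX [connX he]]]; tfae.
- exact: P_h_circle.
- by move=> ->; left; exists 0%N.
- exact: minimal_degree2.
- move=> deg2; have [turn turnP] := exists_turn he deg2.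
  have [n0 _] := he.
  exact: (traversal_homeomorphic_to_circle hX he turnP (Ordinal n0, false) connX cX).
Qed.
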